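(* Let $q\ge 3$ be a prime power, let $m\ge 2$ and let $n$ be an odd positive integer. Let $\operatorname{TSRP}(m,n,q)$ be the set of primitive TSR matrices of order $n$ over $\mathbb{F}_{q^m}$ and let $P_q(m,n)$ be the set of primitive polynomials of degree $n$ in $\mathbb{F}_{q^m}[X]$ of the form $X^n-\mu g(X)$, where $\mu$ is a primitive element of $\mathbb{F}_{q^m}$ and $g(X)\in\mathbb{F}_q[X]$ satisfies $g(0)=1$ and $\deg g\le n-1$. Then $$|\operatorname{TSRP}(m,n,q)| = \frac{|P_q(m,n)|}{m}\cdot\frac{|\mathbb{GL}_m(\mathbb{F}_q)|}{q^m-1}.$$
   Context: A polynomial of degree $d$ over a finite field $\mathbb{F}_Q$ is primitive if it is monic and irreducible and one (equivalently every) root generates the cyclic group $\mathbb{F}_{Q^d}^*$; an element of $\mathbb{F}_{q^m}$ is primitive if it generates $\mathbb{F}_{q^m}^*$. A TSR matrix of order $n$ over $\mathbb{F}_{q^m}$ is an $mn\times mn$ block matrix over $\mathbb{F}_q$ with $m\times m$ blocks of the form $$T=\begin{pmatrix} \mathbf{0} & \mathbf{0} & \cdots & \mathbf{0} & c_0A\\ I_m & \mathbf{0} & \cdots & \mathbf{0} & c_1A\\ \mathbf{0} & I_m & \cdots & \mathbf{0} & c_2A\\ \vdots & & \ddots & & \vdots\\ \mathbf{0} & \mathbf{0} & \cdots & I_m & c_{n-1}A\end{pmatrix},$$ where $c_0,\dots,c_{n-1}\in\mathbb{F}_q$, $A\in M_m(\mathbb{F}_q)$. Such $T$ is primitive if $\det(XI_{mn}-T)\in\mathbb{F}_q[X]$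 is a primitive polynomial of degree $mn$ over $\mathbb{F}_q$. $\operatorname{TSRP}(m,n,q)$ is the set of all primitive TSR matrices of order $n$ over $\mathbb{F}_{q^m}$, and $\mathbb{GL}_m(\mathbb{F}_q)$ is the group of invertible $m\times m$ matrices over $\mathbb{F}_q$. *)

(* Defs.v *)
From mathcomp Require Import all_boot all_order all_algebra all_fingroup.
From mathcomp Require Import all_solvable all_field.

Set Implicit Arguments.
Unset Strict Implicit.
Unset Printing Implicit Defensive.

Import GRing.Theory.
Local Open Scope ring_scope.

Definition primitive_elt (L : finFieldType) (x : L) : bool :=
  [exists u : {unit L}, (val u == x) && generator [set: {unit L}] u].

Definition primitive_poly_of_degree (F : finFieldType) (d : nat)
    (p : {poly F}) : bool :=
  (size p == d.+1) && primitive_poly p.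

(* [primitive_poly] is phrased through the order of 'X modulo p; for a monic
   irreducible p it says that any given root of p in the extension of degree
   (size p).-1 generates the multiplicative group of that extension. *)
Lemma primitive_poly_root (F K : finFieldType) (f : {rmorphism F -> K})
    (p : {poly F}) (x : K) :
    p \is monic -> irreducible_poly p -> #|K| = (#|F| ^ (size p).-1)%N ->
    root (map_poly f p) x ->
  primitive_poly p = primitive_elt x.
Proof.
move=> pM pI cK px.
have cQ : #|{poly %/ p}| = #|K|.
  by rewrite card_monic_qpoly ?cK //; case: pI.
have dvdE n : (p %| 'X^n - 1) = (x ^+ n == 1).
  have rE : root (map_poly f ('X^n - 1)) x = (x ^+ n == 1).
    by rewrite rmorphB /= map_polyXn rmorph1 rootE !hornerE subr_eq0.
  rewrite -rE; apply/idP/idP => [|rx].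
    by rewrite -(dvdp_map f) => /dvdpP[g ->]; rewrite rootM px orbT.
  apply/negPn/negP => ndv.
  have : coprimep p ('X^n - 1).
    by rewrite irreducible_poly_coprime.
  rewrite -(coprimep_map f) => /coprimep_root /(_ px).
  by rewrite -rootE rx.
have K1 : (0 < #|K|.-1)%N by rewrite -subn1 subn_gt0 finNzRing_gt1.
have cU : #|[set: {unit K}]| = #|K|.-1 by rewrite card_finField_unit.
apply/primitive_polyP/existsP; rewrite cQ.
  case=> _; rewrite dvdE => /eqP xv xn.
  have Ux : x \is a GRing.unit.
    by apply/unitrP; exists (x ^+ #|K|.-1.-1); rewrite -exprSr -exprS prednK.
  pose u : {unit K} := FinRing.Unit Ux.
  have uX n : (u ^+ n == 1)%g = (x ^+ n == 1).
    by rewrite -val_eqE FinRing.val_unitX.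
  exists u; rewrite eqxx /= /generator eq_sym eqEcard subsetT /= cU.
  rewrite leqNgt; apply/negP => oK.
  have := xn #[u]%g; rewrite order_gt0 oK => /(_ isT).
  by rewrite dvdE -uX expg_order eqxx.
case=> u /andP[/eqP ux /eqP gu].
have ou : #[u]%g = #|K|.-1 by rewrite /order -gu cU.
have uX n : (x ^+ n == 1) = (#|K|.-1 %| n)%N.
  by rewrite -ou order_dvdn -val_eqE FinRing.val_unitX ux.
split=> [//||n /andP[n0 nv]]; first by rewrite dvdE uX.
by rewrite dvdE uX gtnNdvd.
Qed.

(* The dimension \sum_(i < n) m is the one \mxblock produces for an n x n array
   of m x m blocks; it equals n * m. The last block column is tested first, so
   that n = 1 gives the single block c 0 0 *: A. *)
Definition tsr_mx (F : finFieldType) (m n : nat) (c : 'rV[F]_n) (A : 'M[F]_m) :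
    'M[F]_(\sum_(i < n) m) :=
  \mxblock_(i < n, j < n)
    (if j.+1 == n :> nat then c 0 i *: A
     else if i == j.+1 :> nat then 1%:M else 0).

Definition TSRP (F : finFieldType) (m n : nat) :
    {set 'M[F]_(\sum_(i < n) m)} :=
  [set T | [exists c : 'rV[F]_n, exists A : 'M[F]_m, T == tsr_mx c A]
           && primitive_poly_of_degree (m * n) (char_poly T)].

(* {poly_n F} is the finite type of polynomials of degree at most n - 1. *)
Definition Pq (F L : finFieldType) (iota : {rmorphism F -> L}) (n : nat) :
    {set {poly_(n.+1) L}} :=
  [set f : {poly_(n.+1) L} |
    primitive_poly_of_degree n (f : {poly L})
    && [exists mu : L, exists g : {poly_n F},
         [&& primitive_elt mu, (g : {poly F}).[0] == 1
           & (f : {poly L}) == 'X^n - mu *: map_poly iota (g : {poly F})]]].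

(* Main.v *)
Require Import Defs.
From mathcomp Require Import all_boot all_order all_algebra all_fingroup.
From mathcomp Require Import all_solvable all_field.
Import GRing.Theory.
Local Open Scope ring_scope.

(* Let T = tsr_mx c A and g_c(X) = c_0 + ... + c_(n-1) X^(n-1).
   If w A = mu w and b^n = mu g_c(b), then (w, b w, ..., b^(n-1) w) is an
   eigenvector of T for b. So, for an eigenvalue mu of A in L, a root b of
   X^n - mu g_c(X) is also a root of the characteristic polynomial of T. A monic
   polynomial of degree d over a field with Q elements is primitive iff one of
   its roots has order Q^d - 1; as b serves both for X^n - mu g_c over L and for
   the characteristic polynomial of T over F, and |L|^n = |F|^(mn), the former is
   primitive iff the latter is. In that case the characteristic polynomial of A
   is irreducible, so A has exactly m eigenvalues in L, and each of them is the
   norm of such a b, hence primitive, because n is odd.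

   Normalising c_0 = 1 makes (c, A) unique, and counting the triples (c, A, mu)
   in two ways gives m |TSRP| = |P_q| N, where N is the number of matrices with a
   given irreducible characteristic polynomial p of degree m. Finally
   N (q^m - 1) = |GL_m|: with C the matrix of multiplication by X modulo p, an
   invertible M is determined by A = M^-1 C M and by its first row v, since its
   rows are the v A^i, and every such A and every nonzero v occur. *)

Set Implicit Arguments.
Unset Strict Implicit.

(** * Primitive polynomials and the order of their roots *)

Section PrimitiveRoots.
Variables (F : finFieldType) (E : fieldType) (f : {rmorphism F -> E}).
Implicit Types (p : {poly F}) (b : E) (N : nat).

Lemma root_map_monic_size_gt1 p b :
  p \is monic -> root (map_poly f p) b -> (1 < size p)%N.
Proof.
move=> pM pb; rewrite -(size_map_poly f).
by rewrite (root_size_gt1 _ pb) // map_poly_eq0 monic_neq0.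
Qed.

Lemma horner_map_modp p b (a : {poly F}) :
  root (map_poly f p) b -> (map_poly f (a %% p)).[b] = (map_poly f a).[b].
Proof.
move=> /rootP pb; rewrite [in RHS](divp_eq a p) rmorphD rmorphM /=.
by rewrite hornerD hornerM pb mulr0 add0r.
Qed.

Lemma size_modp_leq p (a : {poly F}) :
  p \is monic -> (size (a %% p)%R <= (size p).-1)%N.
Proof.
move=> pM; have p0 := monic_neq0 pM.
by rewrite -ltnS prednK ?size_poly_gt0 // ltn_modp.
Qed.

(* Evaluation at a root of [p] whose first [N] powers are distinct separates
   these [N.+1] polynomials, so [N < #|F| ^ (size p).-1]. *)
Definition power_residue p N (k : option 'I_N) : {poly_((size p).-1) F} :=
  npolyp (size p).-1 (if k is Some i then 'X^i %% p else 0).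

Lemma horner_power_residue p b N (k : option 'I_N) :
    p \is monic -> root (map_poly f p) b ->
  (map_poly f (power_residue p k)).[b] = if k is Some i then b ^+ i else 0.
Proof.
move=> pM pb; rewrite /power_residue npolypK; last first.
  by case: k => [i|]; [exact: size_modp_leq | rewrite size_poly0].
case: k => [i|]; last by rewrite rmorph0 horner0.
by rewrite horner_map_modp // map_polyXn hornerXn.
Qed.

Lemma power_residue_inj p b N :
    p \is monic -> root (map_poly f p) b -> N.-primitive_root b ->
  injective (@power_residue p N).
Proof.
move=> pM pb bN x y xy.
have b0 : b != 0 by rewrite (prim_root_eq0 bN) -lt0n (prim_order_gt0 bN).
have := horner_power_residue x pM pb.
rewrite xy (horner_power_residue y pM pb).
case: x y {xy} => [i|] [j|] //=.
- move/eqP; rewrite (eq_prim_root_expr bN) !modn_small // => /eqP ij.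
  by congr Some; apply/val_inj.
- by move/esym/eqP; rewrite expf_eq0 (negPf b0) andbF.
- by move/eqP; rewrite expf_eq0 (negPf b0) andbF.
Qed.

Lemma prim_root_order_lt p b N :
    p \is monic -> root (map_poly f p) b -> N.-primitive_root b ->
  (N < #|F| ^ (size p).-1)%N.
Proof.
move=> pM pb bN; have := leq_card _ (power_residue_inj pM pb bN).
by rewrite card_option card_ord card_npoly.
Qed.

(** When [b] has the largest order allowed, [power_residue] is bijective by counting. So a nonzero
    [a] is some ['X^i %% p], and its value at [b] is [b ^+ i]. *)
Lemma horner_small_neq0 p b (a : {poly F}) :
    p \is monic -> root (map_poly f p) b ->
    (#|F| ^ (size p).-1).-1.-primitive_root b ->
    (size a < size p)%N -> a != 0 ->
  (map_poly f a).[b] != 0.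
Proof.
move=> pM pb bN sa a0; set N := _.-1 in bN.
have b0 : b != 0 by rewrite (prim_root_eq0 bN) -lt0n (prim_order_gt0 bN).
have inj := power_residue_inj pM pb bN.
have Q0 : (0 < #|F| ^ (size p).-1)%N.
  by rewrite expn_gt0 (ltnW (finNzRing_gt1 F)).
have [|g gK Kg] := inj_card_bij inj.
  by rewrite card_option card_ord card_npoly prednK.
have sp : (0 < size p)%N by apply: leq_ltn_trans sa.
have aE : a = power_residue p (g (npolyp (size p).-1 a)).
  by rewrite Kg npolypK // -ltnS prednK.
rewrite aE (horner_power_residue _ pM pb).
case gE: (g _) => [i|]; first by rewrite expf_neq0.
by case/eqP: a0; rewrite aE gE /power_residue npolypK // size_poly0.
Qed.

Lemma dvdp_Xn_sub1 p b n :
    irreducible_poly p -> root (map_poly f p) b ->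
  (p %| 'X^n - 1) = (b ^+ n == 1).
Proof.
move=> pI pb.
have rE : root (map_poly f ('X^n - 1)) b = (b ^+ n == 1).
  by rewrite rmorphB /= map_polyXn rmorph1 rootE !hornerE subr_eq0.
rewrite -rE; apply/idP/idP => [|rb].
  by rewrite -(dvdp_map f) => /dvdpP[g ->]; rewrite rootM pb orbT.
apply/negPn/negP => ndv.
have : coprimep p ('X^n - 1) by rewrite irreducible_poly_coprime.
by rewrite -(coprimep_map f) => /coprimep_root /(_ pb); rewrite -rootE rb.
Qed.

(** Irreducibility of [p] comes out of the order of [b] alone, so polynomials over different fields
    can be compared through a common root. *)
Lemma primitive_poly_prim_root p b :
    p \is monic -> root (map_poly f p) b ->
  primitive_poly p = (#|F| ^ (size p).-1).-1.-primitive_root b.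
Proof.
move=> pM pb; have sp := root_map_monic_size_gt1 pM pb.
have cQ : #|{poly %/ p}| = (#|F| ^ (size p).-1)%N by rewrite card_monic_qpoly.
set N := _.-1.
have N0 : (0 < N)%N.
  rewrite /N -subn1 subn_gt0 -[1%N](expn0 #|F|) ltn_exp2l ?finNzRing_gt1 //.
  by rewrite -subn1 subn_gt0.
apply/primitive_polyP/idP; rewrite cQ -/N.
  case=> -[pI _] dN nd.
  move: dN; rewrite (dvdp_Xn_sub1 _ pI pb) => /eqP bN.
  have [k bk kN] := prim_order_exists N0 bN.
  have [<- //|neq] := eqVneq k N.
  have := nd k; rewrite (prim_order_gt0 bk) ltn_neqAle neq (dvdn_leq N0 kN).
  by rewrite (dvdp_Xn_sub1 _ pI pb) (prim_expr_order bk) eqxx => /(_ isT).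
move=> bN.
(* In [p = k * h] with [h] nonconstant, [k] is shorter than [p] and cannot vanish at [b]. Hence [h]
   does, so [h] is not shorter than [p]. *)
have pI : irreducible_poly p.
  split=> // h sh /dvdpP[k pE].
  have p0 := monic_neq0 pM.
  have [k0 h0] : k != 0 /\ h != 0.
    by apply/andP; rewrite -negb_or -mulf_eq0 -pE.
  have /orP rr : root (map_poly f k) b || root (map_poly f h) b.
    by rewrite -rootM -rmorphM -pE.
  have sz : size p = (size k + size h).-1 by rewrite pE size_mul.
  have sk0 : (0 < size k)%N by rewrite size_poly_gt0.
  have sh0 : (0 < size h)%N by rewrite size_poly_gt0.
  have nk : ~~ root (map_poly f k) b.
    apply: (horner_small_neq0 pM pb bN) => //; rewrite sz.
    by case: (size h) sh sh0 => [|[|s]] // _ _; rewrite !addnS /= leq_addr.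
  have rh : root (map_poly f h) b by case: rr => // rk; rewrite rk in nk.
  have hp : h %| p by rewrite pE dvdp_mull.
  rewrite -(dvdp_size_eqp hp).
  rewrite eqn_leq (dvdp_leq p0 hp) /=.
  rewrite leqNgt; apply/negP => lt.
  by have := horner_small_neq0 pM pb bN lt h0; rewrite -rootE rh.
split=> [//||n /andP[n0 nN]].
  by rewrite (dvdp_Xn_sub1 _ pI pb) (prim_expr_order bN).
rewrite (dvdp_Xn_sub1 _ pI pb) -(prim_order_dvd bN).
by rewrite gtnNdvd.
Qed.

End PrimitiveRoots.

(** * Eigenvalues of TSR matrices *)

Lemma horner_map_rVpoly (R S : nzRingType) (f : {rmorphism R -> S}) n
    (c : 'rV[R]_n) (b : S) :
  (map_poly f (rVpoly c)).[b] = \sum_(i < n) f (c 0 i) * b ^+ i.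
Proof.
rewrite (@horner_coef_wide _ n); last first.
  by rewrite (leq_trans (size_poly _ _)) // size_poly.
by apply: eq_bigr => i _; rewrite coef_map coef_rVpoly_ord.
Qed.

Lemma root_char_poly_tsr (F : finFieldType) (E : fieldType)
    (f : {rmorphism F -> E}) (m n : nat) (c : 'rV[F]_n) (A : 'M[F]_m)
    (a b : E) :
    (0 < n)%N -> root (map_poly f (char_poly A)) a ->
    b ^+ n = a * (map_poly f (rVpoly c)).[b] ->
  root (map_poly f (char_poly (tsr_mx c A))) b.
Proof.
move=> n0; rewrite !map_char_poly -!eigenvalue_root_char.
case/eigenvalueP=> w wA w0 bn; apply/eigenvalueP.
pose W i : 'M_(1, m) := b ^+ i *: w.
pose v : 'rV[E]_(\sum_(i < n) m) := \mxrow_(i < n) W i.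
exists v; last first.
  apply/eqP => /(congr1 (fun M => submxrow M (Ordinal n0))) v0.
  by case/eqP: w0; move: v0; rewrite /v mxrowK submxrow0 /W scale1r.
have -> : map_mx f (tsr_mx c A) = \mxblock_(i < n, j < n) map_mx f
    (if j.+1 == n :> nat then c 0 i *: A
     else if i == j.+1 :> nat then 1%:M else 0).
  by apply/matrixP => i j; rewrite !mxE.
have -> : b *: v = \mxrow_(i < n) (b *: W i).
  by apply/matrixP => i j; rewrite !mxE.
(* Each block column but the last moves [W] one step on; the last one gives [b ^+ n *: w] by the
   equation for [b]. *)
rewrite /v mul_mxrow_mxblock; apply: eq_mxrow => j; rewrite /W scalerA -exprS.
case: eqP => [jn|/eqP jn].
  rewrite jn bn horner_map_rVpoly mulr_sumr scaler_suml; apply: eq_bigr => i _.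
  rewrite map_mxZ -scalemxAl -scalemxAr wA !scalerA.
  by rewrite mulrC [f _ * _]mulrC.
have jn' : (j.+1 < n)%N by rewrite ltn_neqAle jn ltn_ord.
rewrite (bigD1 (Ordinal jn')) //= eqxx map_mx1 mulmx1 big1 ?addr0 // => i ne.
have /negPf -> : i != j.+1 :> nat.
  by apply: contraNneq ne => /= e; apply/eqP/val_inj.
by rewrite map_mx0 mulmx0.
Qed.

(** This freedom in the pair [(c, A)] is what the normalisation [c 0 ord0 = 1] removes. *)
Lemma tsr_mxZ (F : finFieldType) m n (c : 'rV[F]_n) (A : 'M[F]_m) (a : F) :
  tsr_mx (a *: c) A = tsr_mx c (a *: A).
Proof.
apply: eq_mxblock => i j; case: ifP => // _.
by rewrite mxE scalerA mulrC.
Qed.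

Lemma tsr_mx_inj (F : finFieldType) m n (i0 : 'I_n) (c d : 'rV[F]_n)
    (A B : 'M[F]_m) :
    c 0 i0 = 1 -> d 0 i0 = 1 -> A != 0 -> tsr_mx c A = tsr_mx d B ->
  c = d /\ A = B.
Proof.
move=> c0 d0 A0 cd.
have n0 : (0 < n)%N by apply: leq_ltn_trans (ltn_ord i0).
have lt : (n.-1 < n)%N by rewrite prednK.
have blk i : c 0 i *: A = d 0 i *: B.
  have := congr1 (fun M => submxblock M i (Ordinal lt)) cd.
  by rewrite !mxblockK /= prednK // eqxx.
have AB : A = B by have := blk i0; rewrite c0 d0 !scale1r.
split=> //; apply/rowP => i; apply/eqP; rewrite -subr_eq0.
have := blk i; rewrite -AB => /eqP; rewrite -subr_eq0 -scalerBl scaler_eq0.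
by rewrite (negPf A0) orbF.
Qed.

Lemma tsr_dim (m n : nat) : (\sum_(i < n) m = m * n)%N.
Proof. by rewrite sum_nat_const card_ord mulnC. Qed.

(** * Shift polynomials *)

(** Both criteria for primitive polynomials are applied to ['X - x%:P], whose only root is [x]. *)
Lemma primitive_elt_prim_root (L : finFieldType) (x : L) :
  primitive_elt x = #|L|.-1.-primitive_root x.
Proof.
have xM : 'X - x%:P \is monic by rewrite monicXsubC.
have rx : root (map_poly idfun ('X - x%:P)) x.
  by rewrite map_poly_id // root_XsubC.
rewrite -(primitive_poly_root (f := idfun) xM) //; first 1 last.
- split=> [|h sh hx]; first by rewrite size_XsubC.
  have h0 : h != 0.
    apply: contraTneq hx => ->.
    by rewrite dvd0p polyXsubC_eq0.
  rewrite -(dvdp_size_eqp hx) size_XsubC eqn_leq.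
  have := dvdp_leq (monic_neq0 xM) hx; rewrite size_XsubC => -> /=.
  by case: (size h) sh (size_poly_gt0 h) => [|[|]] //; rewrite h0.
- by rewrite size_XsubC expn1.
by rewrite (primitive_poly_prim_root xM rx) size_XsubC expn1.
Qed.

Lemma size_monic_Xn_sub (R : nzRingType) n (r : {poly R}) :
  (size r <= n)%N -> size ('X^n - r) = n.+1 /\ 'X^n - r \is monic.
Proof.
move=> sr; have s : (size (- r) < size ('X^n : {poly R}))%N.
  by rewrite size_polyXn size_polyN.
by rewrite size_polyDl // size_polyXn monicE lead_coefDl // lead_coefXn.
Qed.

(** Raising to the power [#|L|], a power of the characteristic, is additive and fixes the
    coefficients, which come from [L]. *)
Lemma root_map_expf_card (L : finFieldType) (E : fieldType)
    (g : {rmorphism L -> E}) (p : {poly L}) (b : E) :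
  root (map_poly g p) b -> root (map_poly g p) (b ^+ #|L|).
Proof.
have [r r_pr rL] := finPcharP L.
have rE : r \in [pchar E] := rmorph_pchar g rL.
have Qnat : [pchar E].-nat #|L|.
  rewrite (eq_pnat _ (pcharf_eq rE)) -cardsT.
  exact: abelem_pgroup (fin_ring_pchar_abelem rL).
have L0 : (0 < #|L|)%N by apply: ltnW (finNzRing_gt1 L).
move=> /rootP pb; apply/rootP.
rewrite -[RHS](_ : (map_poly g p).[b] ^+ #|L| = 0); last first.
  by rewrite pb expr0n gtn_eqF.
rewrite !horner_coef (big_morph (fun x => x ^+ #|L|) (id1 := 0) (op1 := +%R)).
- apply: eq_bigr => i _; rewrite exprMn coef_map -rmorphXn /= expf_card.
  by rewrite -!exprM mulnC.
- by move=> x y; rewrite exprDn_pchar.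
- by rewrite expr0n gtn_eqF.
Qed.

Section ShiftPolynomial.
Variables (F L : finFieldType) (phi : {rmorphism F -> L}) (m n : nat).
Hypotheses (n_gt0 : (0 < n)%N) (cardL : #|L| = (#|F| ^ m)%N).
Implicit Types (c : 'rV[F]_n) (A : 'M[F]_m) (mu : L).

Definition shift_poly c mu : {poly L} := 'X^n - mu *: map_poly phi (rVpoly c).

Lemma size_shift_poly_tail c mu :
  (size (mu *: map_poly phi (rVpoly c)) <= n)%N.
Proof.
rewrite (leq_trans (size_scale_leq _ _)) // size_map_poly.
exact: size_poly.
Qed.

Lemma size_shift_poly c mu : size (shift_poly c mu) = n.+1.
Proof. by case: (size_monic_Xn_sub (size_shift_poly_tail c mu)). Qed.

Lemma shift_poly_monic c mu : shift_poly c mu \is monic.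
Proof. by case: (size_monic_Xn_sub (size_shift_poly_tail c mu)). Qed.

Lemma size_char_poly_tsr (k : nat) (c : 'rV[F]_n) (A : 'M[F]_k) :
  size (char_poly (tsr_mx c A)) = (k * n).+1.
Proof. by rewrite size_char_poly tsr_dim. Qed.

Lemma root_shift_polyE (E : fieldType) (g : {rmorphism L -> E}) c mu b :
  root (map_poly g (shift_poly c mu)) b =
    (b ^+ n == g mu * (map_poly (g \o phi) (rVpoly c)).[b]).
Proof.
rewrite rmorphB /= map_polyXn map_polyZ /= -map_poly_comp rootE !hornerE.
by rewrite subr_eq0.
Qed.

Lemma root_tsr_shift (E : fieldType) (g : {rmorphism L -> E}) c A mu b :
    root (map_poly phi (char_poly A)) mu ->
    root (map_poly g (shift_poly c mu)) b ->
  root (map_poly (g \o phi) (char_poly (tsr_mx c A))) b.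
Proof.
rewrite root_shift_polyE => rA /eqP bn.
apply: (root_char_poly_tsr n_gt0 (a := g mu)) => //.
by rewrite map_poly_comp /= fmorph_root.
Qed.

Lemma shift_poly_root_ex c mu :
  {E : fieldType & {g : {rmorphism L -> E} &
    {b | root (map_poly g (shift_poly c mu)) b}}}.
Proof.
have [E [g _]] := countable_algebraic_closure L.
exists E, g; apply/sigW/closed_rootP.
by rewrite size_map_poly size_shift_poly eqSS -lt0n.
Qed.

Lemma primitive_shift_poly_tsr c A mu :
    root (map_poly phi (char_poly A)) mu ->
  primitive_poly (shift_poly c mu) = primitive_poly (char_poly (tsr_mx c A)).
Proof.
move=> rA; have [E [g [b rb]]] := shift_poly_root_ex c mu.
rewrite (primitive_poly_prim_root (shift_poly_monic c mu) rb).
rewrite (primitive_poly_prim_root (char_poly_monic _) (root_tsr_shift rA rb)).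
by rewrite size_shift_poly size_char_poly_tsr /= cardL -expnM.
Qed.

(** A factor of degree [d] shares an eigenvalue [a] with its companion matrix. A root [b] attached
    to [a] is then also a root of a TSR characteristic polynomial of degree [d * n], and the order
    of [b] forces [m <= d]. *)
Lemma primitive_tsr_irreducible c A : (0 < m)%N ->
  primitive_poly (char_poly (tsr_mx c A)) -> irreducible_poly (char_poly A).
Proof.
move=> m0 pT; split=> [|h sh hA]; first by rewrite size_char_poly.
have A0 := monic_neq0 (char_poly_monic A).
have h0 : h != 0 by apply: contraNneq A0 => h0; rewrite h0 dvd0p in hA.
rewrite -(dvdp_size_eqp hA) eqn_leq dvdp_leq //= size_char_poly.
pose h1 := (lead_coef h)^-1 *: h.
have lh : (lead_coef h)^-1 != 0 by rewrite invr_eq0 lead_coef_eq0.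
have h1M : h1 \is monic by rewrite monicE lead_coefZ mulVf // lead_coef_eq0.
have sh1 : size h1 = size h by rewrite size_scale.
have [E [f _]] := countable_algebraic_closure F.
have [a ra] : exists a, root (map_poly f h1) a.
  by apply/closed_rootP; rewrite size_map_poly sh1.
have [b rb] : exists b, root ('X^n - a *: map_poly f (rVpoly c)) b.
  apply/closed_rootP.
  have [|-> _] := @size_monic_Xn_sub _ n (a *: map_poly f (rVpoly c)).
    rewrite (leq_trans (size_scale_leq _ _)) // size_map_poly.
    exact: size_poly.
  by rewrite eqSS -lt0n.
have {rb} bn : b ^+ n = a * (map_poly f (rVpoly c)).[b].
  by apply/eqP; rewrite -subr_eq0; move: rb; rewrite rootE !hornerE.
have rT : root (map_poly f (char_poly (tsr_mx c A))) b.
  apply: (root_char_poly_tsr n_gt0 _ bn).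
  have /dvdpP[k ->] : h1 %| char_poly A by rewrite dvdpZl.
  by rewrite rmorphM rootM ra orbT.
have rT' : root (map_poly f (char_poly (tsr_mx c (companionmx h1)))) b.
  by apply: (root_char_poly_tsr n_gt0 _ bn); rewrite companionmxK.
move: pT; rewrite (primitive_poly_prim_root (char_poly_monic _) rT) => pb.
have := prim_root_order_lt (char_poly_monic _) rT' pb.
rewrite !size_char_poly_tsr /= prednK; last first.
  by rewrite expn_gt0 (ltnW (finNzRing_gt1 F)).
rewrite leq_exp2l ?finNzRing_gt1 // leq_pmul2r // sh1 => me.
by rewrite (leq_ltn_trans me) // prednK // size_poly_gt0.
Qed.

(* [- mu] is the constant term of [shift_poly c mu], hence, for [n] odd, minus
   the product of the [n] conjugates of [b] over [L]. *)
Lemma primitive_elt_tsr_eigenvalue c A mu (i0 : 'I_n) :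
    odd n -> i0 = 0%N :> nat -> c 0 i0 = 1 ->
    root (map_poly phi (char_poly A)) mu ->
    primitive_poly (char_poly (tsr_mx c A)) ->
  primitive_elt mu.
Proof.
move=> n_odd i00 c0 rA; rewrite -(primitive_shift_poly_tsr c rA).
have [E [g [b rb]]] := shift_poly_root_ex c mu.
rewrite (primitive_poly_prim_root (shift_poly_monic c mu) rb).
rewrite size_shift_poly /= primitive_elt_prim_root; set N := _.-1 => bN.
have Q1 := finNzRing_gt1 L; set Q := #|L| in N bN Q1 *.
(* These are the conjugates of [b] over [L]. *)
pose rs := [seq b ^+ (Q ^ i) | i <- iota 0 n].
have NE : N = (Q.-1 * \sum_(i < n) Q ^ i)%N by rewrite -predn_exp.
have rs_root : all (root (map_poly g (shift_poly c mu))) rs.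
  apply/allP=> _ /mapP[i _ ->]; elim: i => [|i IHi] //.
  by rewrite expnSr exprM root_map_expf_card.
have rs_uniq : uniq rs.
  rewrite map_inj_in_uniq ?iota_uniq // => i j.
  rewrite !mem_iota /= !add0n => ltin ltjn /eqP.
  (* For [n = 1] the bound [small] can fail, since [Q = 2] gives [N = 1]; but then both indices are
     0. *)
  have [n1|n1] := leqP n 1.
    move: (leq_trans ltin n1) (leq_trans ltjn n1).
    by case: i j {ltin ltjn} => [|?] [|?].
  have small k : (k < n)%N -> (Q ^ k < N)%N.
    move=> kn; have kn1 : (k <= n.-1)%N by rewrite -ltnS prednK.
    rewrite (leq_ltn_trans (leq_pexp2l (ltnW Q1) kn1)) // /N ltn_predRL.
    have Qn : (Q ^ n = Q * Q ^ n.-1)%N by rewrite -expnS prednK.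
    have Qn1 : (1 < Q ^ n.-1)%N.
      by rewrite -[1%N](expn0 Q) ltn_exp2l // ltn_predRL.
    rewrite Qn (leq_trans _ (leq_mul Q1 (leqnn _))) //.
    by rewrite mul2n -addnn -addn1 ltn_add2l.
  by rewrite (eq_prim_root_expr bN) !modn_small ?small // => /eqP /(expnI Q1).
(* The [n] distinct conjugates are all the roots, so the polynomial splits; constant terms are then
   compared. *)
have := all_roots_prod_XsubC _ rs_root; rewrite uniq_rootsE size_map_poly.
rewrite size_shift_poly size_map size_iota => /(_ erefl rs_uniq).
rewrite (monicP _) ?map_monic ?shift_poly_monic // scale1r.
move/(congr1 (fun p => p.[0])); rewrite rmorphB /= map_polyXn map_polyZ /=.
rewrite !hornerE expr0n gtn_eqF // -map_poly_comp horner_map_rVpoly.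
rewrite (bigD1 i0) //= i00 c0 !rmorph1 mulr1 big1 => [|i ne]; last first.
  have /negPf i_neq0 : i != 0%N :> nat.
    by apply: contraNneq ne => i0'; apply/eqP/val_inj; rewrite /= i0' i00.
  by rewrite expr0n i_neq0 mulr0.
rewrite addr0 mulr1 sub0r horner_prod big_map => mu_prod.
have gmu : g mu = b ^+ (\sum_(i < n) Q ^ i).
  apply: oppr_inj; rewrite mu_prod -[n in iota 0 n]subn0 -/(index_iota 0 n).
  rewrite big_mkord (eq_bigr (fun i : 'I_n => - b ^+ (Q ^ i))) => [|i _].
    by rewrite prodrN card_ord -signr_odd n_odd mulN1r -prodrXr.
  by rewrite !hornerE.
have Q0 : (0 < Q.-1)%N by rewrite ltn_predRL.
(* The exponent is [N %/ Q.-1], so this power of [b] has order exactly [Q.-1]. *)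
rewrite -(fmorph_primitive_root g) gmu -(mulKn (\sum_(i < n) Q ^ i) Q0) -NE.
by rewrite dvdn_prim_root // NE dvdn_mulr.
Qed.

End ShiftPolynomial.

(** * Irreducible polynomials over a finite field and their roots in an extension *)

(** The class of ['X] in the finite field of residues modulo [p] is fixed by raising to the
    cardinality of that field. *)
Lemma irreducible_dvdp_genPoly (F : finFieldType) (p : {poly F}) :
    p \is monic -> irreducible_poly p ->
  p %| 'X^(#|F| ^ (size p).-1) - 'X.
Proof.
move=> pM pI; have mi : monic_irreducible_poly p by split.
have := expf_card (in_qpoly p 'X : {poly %/ p with mi}).
rewrite card_qfpoly; set N := (_ ^ _)%N => xN.
have {xN} : in_qpoly p ('X^N - 'X) = 0.
  by rewrite rmorphB rmorphXn; apply/eqP; rewrite subr_eq0; apply/eqP.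
move/(congr1 val) => /=; rewrite -Pdiv.IdomainMonic.modpE ?monic_mk_monic //.
by rewrite (mk_monicE mi) => /eqP.
Qed.

(** Over [L], [p] divides the product of all ['X - x%:P], so it splits into distinct linear
    factors. *)
Lemma card_root_irreducible (F L : finFieldType) (phi : {rmorphism F -> L})
    (p : {poly F}) :
    p \is monic -> irreducible_poly p -> #|L| = (#|F| ^ (size p).-1)%N ->
  #|[set x | root (map_poly phi p) x]| = (size p).-1.
Proof.
move=> pM pI cL; have := irreducible_dvdp_genPoly pM pI.
rewrite -cL -(dvdp_map phi) rmorphB /= map_polyXn map_polyX finField_genPoly.
rewrite -big_enum /= => /dvdp_prod_XsubC[s]; set r := mask s _ => pr.
have ur : uniq r by rewrite mask_uniq // enum_uniq.
have pE : map_poly phi p = \prod_(x <- r) ('X - x%:P).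
  by apply/eqP; rewrite -eqp_monic ?map_monic // monic_prod_XsubC.
have := size_map_poly phi p; rewrite pE size_prod_XsubC => <- /=.
rewrite -(card_uniqP ur); apply: eq_card => x.
by rewrite inE root_prod_XsubC.
Qed.

(** By pigeonhole two polynomials of degree at most [m] agree at [mu]; [p] is their normalised
    difference. The order of [mu] forces its degree to be [m], and then makes it primitive, hence
    irreducible. *)
Lemma primitive_elt_root_irreducible (F L : finFieldType)
    (phi : {rmorphism F -> L}) (m : nat) (mu : L) :
    #|L| = (#|F| ^ m)%N -> primitive_elt mu ->
  exists p : {poly F}, [/\ p \is monic, irreducible_poly p, size p = m.+1
    & root (map_poly phi p) mu].
Proof.
move=> cL; rewrite primitive_elt_prim_root cL => muP.
have Q0 : (0 < #|F| ^ m)%N by rewrite -cL (ltnW (finNzRing_gt1 L)).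
pose ev (a : {poly_(m.+1) F}) := (map_poly phi a).[mu].
have /injectivePn[a [b ab evab]] : ~~ injectiveb ev.
  apply/negP => /injectiveP /leq_card.
  by rewrite card_npoly cL leq_exp2l ?finNzRing_gt1 // ltnn.
pose d : {poly F} := (a : {poly F}) - (b : {poly F}).
have d0 : d != 0 by rewrite subr_eq0; apply: contraNneq ab => /val_inj ->.
have ld0 : lead_coef d != 0 by rewrite lead_coef_eq0.
pose p := (lead_coef d)^-1 *: d.
have pM : p \is monic by rewrite monicE lead_coefZ mulVf.
have rp : root (map_poly phi p) mu.
  rewrite map_polyZ rootZ ?fmorph_eq0 ?invr_eq0 //= rmorphB rootE.
  by rewrite hornerD hornerN subr_eq0; apply/eqP.
have sp : size p = m.+1.
  apply/eqP; rewrite eqn_leq; apply/andP; split.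
    rewrite size_scale ?invr_eq0 // (leq_trans (size_polyD _ _)) // size_polyN.
    by rewrite geq_max !size_npoly.
  have := prim_root_order_lt pM rp muP; rewrite prednK //.
  rewrite leq_exp2l ?finNzRing_gt1 // => le.
  rewrite (leq_ltn_trans le) // prednK //.
  by rewrite size_poly_gt0 monic_neq0.
exists p; split=> //; have := primitive_poly_prim_root pM rp.
by rewrite sp muP => /primitive_polyP[[]].
Qed.

Lemma root_char_polyE (F L : finFieldType) (phi : {rmorphism F -> L}) (m : nat)
    (A : 'M[F]_m) (p : {poly F}) (mu : L) :
    p \is monic -> irreducible_poly p -> size p = m.+1 ->
    root (map_poly phi p) mu ->
  root (map_poly phi (char_poly A)) mu = (char_poly A == p).
Proof.
move=> pM pI sp rp; apply/idP/eqP => [rA|-> //].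
have pA : p %| char_poly A.
  apply/negPn/negP => ndv.
  have : coprimep p (char_poly A) by rewrite irreducible_poly_coprime.
  by rewrite -(coprimep_map phi) => /coprimep_root /(_ rp); rewrite -rootE rA.
apply/esym/eqP; rewrite -eqp_monic ?char_poly_monic //.
by rewrite -(dvdp_size_eqp pA) sp size_char_poly.
Qed.

(** * Matrices with a given irreducible characteristic polynomial *)

Lemma char_poly_similar (F : fieldType) n (M A C : 'M[F]_n) :
  M \in unitmx -> M *m A = C *m M -> char_poly A = char_poly C.
Proof.
rewrite unitmxE unitfE => dM MA; pose MX := map_mx polyC M.
have dMX : \det MX != 0 by rewrite det_map_mx polyC_eq0.
apply: (mulfI dMX); rewrite [RHS]mulrC /char_poly -!det_mulmx.
congr (\det _); rewrite /char_poly_mx mulmxBr mulmxBl -!map_mxM MA.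
by rewrite scalar_mxC.
Qed.

Section Krylov.
Variables (F : finFieldType) (k : nat) (p : {poly F}).
Hypotheses (pM : p \is monic) (pI : irreducible_poly p).
Hypothesis size_p : size p = k.+2.
Implicit Types (A M : 'M[F]_k.+1) (v : 'rV[F]_k.+1).

Definition krylov_mx A v : 'M[F]_k.+1 := \matrix_i (v *m A ^+ i).

Lemma mul_krylov_mx A v w :
  w *m krylov_mx A v = v *m horner_mx A (rVpoly w).
Proof.
rewrite mulmx_sum_row /rVpoly poly_def rmorph_sum mulmx_sumr.
apply: eq_bigr => i _; rewrite rowK valK /= horner_mxZ rmorphXn /= horner_mx_X.
by rewrite scalemxAr.
Qed.

(** A row [w] in the kernel is a polynomial of degree at most [k] with [v *m w(A) = 0]. If nonzero
    it is coprime to [p], so [w(A)] is invertible by Bezout and Cayley-Hamilton, and [v = 0]. *)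
Lemma krylov_mx_unit A v :
  char_poly A = p -> v != 0 -> krylov_mx A v \in unitmx.
Proof.
move=> Ap v0; rewrite -row_free_unit -kermx_eq0.
apply/rowV0P => w /sub_kermxP; rewrite mul_krylov_mx => va.
apply/eqP/negPn/negP => w0; case/eqP: v0.
have a0 : rVpoly w != 0.
  apply: contraNneq w0 => /(congr1 (@poly_rV _ k.+1)).
  by rewrite rVpolyK linear0 => ->.
have : coprimep p (rVpoly w).
  rewrite irreducible_poly_coprime //; apply/negP => /(dvdp_leq a0).
  by rewrite size_p leqNgt ltnS size_poly.
case/Bezout_eq1_coprimepP=> u /(congr1 (horner_mx A)).
rewrite rmorphD !rmorphM rmorph1 /= -[in horner_mx A p]Ap.
rewrite Cayley_Hamilton mulr0 add0r.
move=> uA; rewrite -[v]mulmx1 -[1%:M]/1 -uA.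
have -> : horner_mx A u.2 * horner_mx A (rVpoly w) =
    horner_mx A (rVpoly w) * horner_mx A u.2 by rewrite -!rmorphM mulrC.
by rewrite mulmxA va mul0mx.
Qed.

(** The companion matrix of [p]: multiplication by ['X] modulo [p] on rows of coefficients. *)
Definition mulX_mx : 'M[F]_k.+1 := \matrix_i poly_rV ('X^(i.+1) %% p).

(** Both sides have rows [v *m A ^+ i.+1], since [A] satisfies [p] and reduction modulo [p] does not
    change the value at [A]. *)
Lemma mulX_krylov_mx A v :
  char_poly A = p -> krylov_mx A v *m A = mulX_mx *m krylov_mx A v.
Proof.
move=> Ap; apply/row_matrixP => i; rewrite !row_mul !rowK mul_krylov_mx.
rewrite poly_rV_K; last by rewrite -ltnS -size_p ltn_modp monic_neq0.
have -> : horner_mx A ('X^(i.+1) %% p) = A ^+ i.+1.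
  rewrite -[in RHS](horner_mx_X A) -rmorphXn [in RHS](divp_eq 'X^(i.+1) p).
  rewrite rmorphD rmorphM /= -[in horner_mx A p]Ap.
  by rewrite Cayley_Hamilton mulr0 add0r.
by rewrite -mulmxA exprSr.
Qed.

(** Any matrix with characteristic polynomial [p] is similar to [mulX_mx] through a Krylov matrix;
    [companionmx p] provides one. *)
Lemma char_poly_mulX_mx : char_poly mulX_mx = p.
Proof.
have [A Ap] : exists A : 'M[F]_k.+1, char_poly A = p.
  move: (companionmxK pM); move: (companionmx p); rewrite size_p => A.
  by exists A.
have v0 : const_mx 1 != 0 :> 'rV[F]_k.+1.
  by apply/eqP => /rowP/(_ 0); rewrite !mxE; apply/eqP; rewrite oner_eq0.
by rewrite -(char_poly_similar (krylov_mx_unit Ap v0) (mulX_krylov_mx _ Ap)).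
Qed.

(** The first basis row stands for the polynomial 1, and the powers of ['X] up to [k] need no
    reduction modulo [p]. *)
Lemma delta_mulX_mx i : (i < k.+1)%N ->
  delta_mx 0 ord0 *m mulX_mx ^+ i = delta_mx 0 (inord i) :> 'rV[F]_k.+1.
Proof.
elim: i => [_|i IHi ik].
  by rewrite expr0 mulmx1; congr delta_mx; apply/val_inj; rewrite /= inordK.
have ik' : (i < k.+1)%N by apply: ltnW.
rewrite exprSr -[mulX_mx ^+ i * _]/(_ *m _) mulmxA IHi // -rowE rowK inordK //.
rewrite modp_small ?size_polyXn ?size_p //; apply/rowP => j.
by rewrite !mxE eqxx coefXn -val_eqE /= inordK.
Qed.

Lemma krylov_mx_conj M : M \in unitmx ->
  krylov_mx (invmx M *m mulX_mx *m M) (delta_mx 0 ord0 *m M) = M.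
Proof.
move=> uM; apply/row_matrixP => i; rewrite rowK rowE.
have -> : (invmx M *m mulX_mx *m M) ^+ i = invmx M *m mulX_mx ^+ i *m M.
  elim: (i : nat) => [|j IHj]; first by rewrite !expr0 mulmx1 mulVmx.
  rewrite !exprSr IHj -[LHS]/(_ *m _ *m _ *m _) -[mulX_mx ^+ j * _]/(_ *m _).
  by rewrite !mulmxA mulmxK.
rewrite !mulmxA mulmxK // delta_mulX_mx //; congr (delta_mx _ _ *m _).
by apply/val_inj; rewrite /= inordK.
Qed.

Lemma card_char_poly_eq :
  (#|[set A : 'M[F]_k.+1 | char_poly A == p]| * (#|F| ^ k.+1).-1)%N
    = #|'GL_k.+1[F]%g|.
Proof.
pose Phi M := (invmx M *m mulX_mx *m M, delta_mx 0 ord0 *m M : 'rV_k.+1).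
have PhiK : {in unitmx, cancel Phi (fun x => krylov_mx x.1 x.2)}.
  by move=> M uM; apply: krylov_mx_conj.
have -> : #|'GL_k.+1[F]%g| = #|[set M : 'M[F]_k.+1 | M \in unitmx]|.
  rewrite cardsT /= card_sub; apply: eq_card => M.
  by rewrite !inE.
have <- : #|[set Phi M | M in [set M : 'M[F]_k.+1 | M \in unitmx]]| =
    #|[set M : 'M[F]_k.+1 | M \in unitmx]|.
  apply: card_in_imset => M N; rewrite !inE => uM uN MN.
  by rewrite -(PhiK M uM) MN PhiK.
have -> : (#|F| ^ k.+1).-1 = #|[set v : 'rV[F]_k.+1 | v != 0]|.
  rewrite -[k.+1 in LHS]mul1n -card_mx -(cardC1 (0 : 'rV[F]_k.+1)).
  by apply: eq_card => v; rewrite !inE.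
(* The image of [Phi] is the full product; a preimage of [(A, v)] is its Krylov matrix. *)
rewrite -cardsX; apply: eq_card => -[A v]; rewrite !inE /=.
apply/andP/imsetP => [[/eqP Ap v0]|[M]].
  have uM := krylov_mx_unit Ap v0; exists (krylov_mx A v); first by rewrite inE.
  congr pair; first by rewrite -mulmxA -mulX_krylov_mx // mulKmx.
  by rewrite -rowE rowK expr0 mulmx1.
rewrite inE => uM [-> ->]; split.
  apply/eqP; rewrite -[RHS]char_poly_mulX_mx.
  by apply: (char_poly_similar uM); rewrite !mulmxA mulmxV // mul1mx.
apply/eqP => /(congr1 (mulmx^~ (invmx M))); rewrite mulmxK // mul0mx.
by move/matrixP/(_ 0 ord0)/eqP; rewrite !mxE !eqxx oner_eq0.
Qed.

End Krylov.

(** * Double counting *)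

(** Otherwise 0 would be a root of the primitive characteristic polynomial. This makes [A] nonzero
    and lets [c 0 ord0] be scaled to 1. *)
Lemma primitive_tsr_eigen_neq0 (F : finFieldType) (E : fieldType)
    (f : {rmorphism F -> E}) (m n : nat) (c : 'rV[F]_n.+1) (A : 'M[F]_m)
    (a : E) :
    primitive_poly (char_poly (tsr_mx c A)) ->
    root (map_poly f (char_poly A)) a ->
  a * f (c 0 ord0) != 0.
Proof.
move=> pT ra; apply/eqP => ac0.
have r0 : root (map_poly f (char_poly (tsr_mx c A))) 0.
  apply: (root_char_poly_tsr (ltn0Sn n) ra).
  rewrite horner_map_rVpoly big_ord_recl /= mulrDr mulr1 ac0 add0r expr0n.
  by rewrite big1 ?mulr0 // => i _; rewrite expr0n mulr0.
move: pT; rewrite (primitive_poly_prim_root (char_poly_monic _) r0) => p0.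
by have := prim_root_eq0 p0; rewrite eqxx gtn_eqF ?(prim_order_gt0 p0).
Qed.

Section DoubleCount.
Variables (F L : finFieldType) (phi : {rmorphism F -> L}) (k n : nat).
Hypothesis cardL : #|L| = (#|F| ^ k.+1)%N.
Local Notation m := k.+1.

Definition tsr_params : {set 'rV[F]_n.+1 * 'M[F]_m} :=
  [set x : 'rV[F]_n.+1 * 'M[F]_m |
    (x.1 0 ord0 == 1) && primitive_poly (char_poly (tsr_mx x.1 x.2))].

Definition shift_params : {set 'rV[F]_n.+1 * L} :=
  [set y : 'rV[F]_n.+1 * L | [&& y.1 0 ord0 == 1, primitive_elt y.2
             & primitive_poly (shift_poly phi y.1 y.2)]].

Lemma card_TSRP : #|TSRP F m n.+1| = #|tsr_params|.
Proof.
have inj : {in tsr_params &, injective (fun x => tsr_mx x.1 x.2)}.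
  move=> [c A] [d B]; rewrite !inE /= => /andP[/eqP c0 pT] /andP[/eqP d0 _] cd.
  have A0 : A != 0.
    apply/eqP => A0.
    have r0 : root (map_poly idfun (char_poly A)) 0.
      rewrite map_poly_id // -eigenvalue_root_char; apply/eigenvalueP.
      exists (const_mx 1); first by rewrite A0 mulmx0 scale0r.
      by apply/eqP => /rowP/(_ 0); rewrite !mxE; apply/eqP; rewrite oner_eq0.
    by have := primitive_tsr_eigen_neq0 pT r0; rewrite mul0r eqxx.
  by have [-> ->] := tsr_mx_inj c0 d0 A0 cd.
rewrite -(card_in_imset inj); apply: eq_card => T; rewrite inE.
apply/andP/imsetP => [[/existsP[c /existsP[A /eqP ->]] /andP[_ pT]]|].
  have [E [f _]] := countable_algebraic_closure F.
  have [a ra] : exists a, root (map_poly f (char_poly A)) a.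
    by apply/closed_rootP; rewrite size_map_poly size_char_poly.
  have c0 : c 0 ord0 != 0.
    apply: contraNneq (primitive_tsr_eigen_neq0 pT ra) => ->.
    by rewrite rmorph0 mulr0.
  have Te : tsr_mx c A = tsr_mx ((c 0 ord0)^-1 *: c) (c 0 ord0 *: A).
    by rewrite tsr_mxZ scalerA mulVf // scale1r.
  exists ((c 0 ord0)^-1 *: c, c 0 ord0 *: A) => //.
  by rewrite inE /= mxE mulVf // eqxx -Te.
case=> -[c A]; rewrite inE /= => /andP[_ pT] ->; split.
  by apply/existsP; exists c; apply/existsP; exists A.
by rewrite /primitive_poly_of_degree size_char_poly_tsr eqxx.
Qed.

Lemma primitive_elt_neq0 (x : L) : primitive_elt x -> x != 0.
Proof.
rewrite primitive_elt_prim_root => xP.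
by rewrite (prim_root_eq0 xP) gtn_eqF ?(prim_order_gt0 xP).
Qed.

Lemma coef0_shift_poly (c : 'rV[F]_n.+1) (mu : L) :
  c 0 ord0 = 1 -> (shift_poly phi c mu)`_0 = - mu.
Proof.
move=> c0; rewrite coefB coefXn coefZ coef_map sub0r.
by rewrite (coef_rVpoly_ord c ord0) c0 /= rmorph1 mulr1.
Qed.

(** The constant term [- mu] recovers [mu], and cancelling [mu] then recovers [c]. *)
Lemma card_Pq : #|Pq phi n.+1| = #|shift_params|.
Proof.
pose G (y : 'rV[F]_n.+1 * L) : {poly_(n.+2) L} :=
  npolyp n.+2 (shift_poly phi y.1 y.2).
have GE y : G y = shift_poly phi y.1 y.2 :> {poly L}.
  by rewrite npolypK // size_shift_poly.
have inj : {in shift_params &, injective G}.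
  move=> [c mu] [d nu]; rewrite !inE /=.
  move=> /and3P[/eqP c0 muP _] /and3P[/eqP d0 _ _] /(congr1 (@polyn _ _)).
  rewrite !GE /= => cd.
  have munu : mu = nu.
    by apply: oppr_inj; rewrite -(coef0_shift_poly mu c0) cd coef0_shift_poly.
  move: cd; rewrite -munu => /addrI/oppr_inj/(scalerI (primitive_elt_neq0 muP)).
  move/map_poly_inj/(congr1 (@poly_rV _ n.+1)); rewrite !rVpolyK => -> //.
rewrite -(card_in_imset inj); apply: eq_card => f; rewrite inE.
apply/andP/imsetP => [[/andP[_ fP] /existsP[mu /existsP[g]]]|].
  case/and3P=> muP /eqP g0 /eqP fE.
  have gE : rVpoly (poly_rV g : 'rV_n.+1) = g.
    by rewrite poly_rV_K // size_npoly.
  exists (poly_rV g, mu).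
    rewrite inE /= mxE -horner_coef0 g0 eqxx muP /=.
    by rewrite /shift_poly gE -fE.
  by apply/val_inj; rewrite /= GE /shift_poly /= gE.
case=> -[c mu]; rewrite inE /= => /and3P[/eqP c0 muP fP] ->.
rewrite /primitive_poly_of_degree !GE size_shift_poly eqxx fP; split=> //.
apply/existsP; exists mu; apply/existsP; exists (npolyp n.+1 (rVpoly c)).
rewrite npolypK ?size_poly // muP horner_coef0 (coef_rVpoly_ord c ord0) c0.
by rewrite !eqxx.
Qed.

Lemma card_tsr_params_root :
  odd n.+1 ->
  (#|tsr_params| * m)%N =
    (\sum_(y in shift_params)
       #|[set A : 'M[F]_m | root (map_poly phi (char_poly A)) y.2]|)%N.
Proof.
move=> n_odd.
pose rt (A : 'M[F]_m) := [set mu | root (map_poly phi (char_poly A)) mu].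
transitivity (\sum_(x in tsr_params) #|rt x.2|)%N.
  rewrite -sum_nat_const; apply: eq_bigr => -[c A].
  rewrite inE /= => /andP[_ pT].
  rewrite card_root_irreducible ?size_char_poly ?char_poly_monic //.
  exact: primitive_tsr_irreducible pT.
transitivity (\sum_(z : 'rV[F]_n.+1 * 'M[F]_m * L |
    (z.1 \in tsr_params) && (z.2 \in rt z.1.2)) 1)%N.
  rewrite -(pair_big_dep (mem tsr_params) (fun x mu => mu \in rt x.2)
    (fun _ _ => 1%N)).
  by apply: eq_bigr => x _; rewrite sum1_card.
transitivity (\sum_(w : 'rV[F]_n.+1 * L * 'M[F]_m |
    (w.1 \in shift_params) && (w.1.2 \in rt w.2)) 1)%N; last first.
  rewrite -(pair_big_dep (mem shift_params) (fun y A => y.2 \in rt A)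
    (fun _ _ => 1%N)).
  apply: eq_bigr => y _; rewrite -sum1_card.
  by apply: eq_bigl => A; rewrite !inE.
rewrite (reindex (fun w : 'rV[F]_n.+1 * L * 'M[F]_m => (w.1.1, w.2, w.1.2)));
  last first.
  by exists (fun z => (z.1.1, z.2, z.1.2)) => [[[]]|[[]]].
(* For an eigenvalue [mu] of [A] the two polynomials are primitive together, and [mu] is then
   primitive too. *)
apply: eq_bigl => -[[c mu] A]; rewrite !inE /=.
have [rA|] := boolP (root _ mu); last by rewrite !andbF.
rewrite !andbT (primitive_shift_poly_tsr (ltn0Sn n) cardL c rA).
have [c0 /=|//] := eqVneq (c 0 ord0) 1.
case pT : (primitive_poly _); last by rewrite andbF.
by rewrite (primitive_elt_tsr_eigenvalue (ltn0Sn n) cardL n_odd (i0 := ord0)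
  _ c0 rA pT).
Qed.

(** Having [mu] as an eigenvalue means having its minimal polynomial as characteristic polynomial,
    so every inner count times [(#|F| ^ m).-1] is the order of the linear group. *)
Lemma card_TSRP_Pq : odd n.+1 ->
  (#|TSRP F m n.+1| * m * (#|F| ^ m).-1 = #|Pq phi n.+1| * #|'GL_m[F]%g|)%N.
Proof.
move=> n_odd; rewrite card_TSRP card_tsr_params_root // card_Pq big_distrl /=.
rewrite -sum_nat_const; apply: eq_bigr => -[c mu].
rewrite inE /= => /and3P[_ muP _].
have [p [pM pI sp rp]] := primitive_elt_root_irreducible phi cardL muP.
rewrite -(card_char_poly_eq pM pI sp); congr (_ * _)%N; apply: eq_card => A.
by rewrite !inE (root_char_polyE A pM pI sp rp).
Qed.

End DoubleCount.

Theorem theorem3p3 (q m n : nat) (F L : finFieldType)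
    (iota : {rmorphism F -> L})
    (hF : #|F| = q) (hL : #|L| = (q ^ m)%N)
    (hq : (3 <= q)%N) (hm : (2 <= m)%N) (hn : odd n) :
  (#|TSRP F m n|%:R : rat) =
    #|Pq iota n|%:R / m%:R * (#|'GL_m[F]%g|%:R / (q%:R ^+ m - 1)).
Proof.
case: m hL hm => // k hL _; case: n hn => // n hn; rewrite -hF in hL hq *.
have Q1 : (1 < #|F| ^ k.+1)%N by rewrite -hL finNzRing_gt1.
have -> : #|F|%:R ^+ k.+1 - 1 = (#|F| ^ k.+1).-1%:R :> rat.
  by rewrite -natrX -[X in X%:R - 1](ltn_predK Q1) -natr1 addrK.
have m0 : k.+1%:R != 0 :> rat by rewrite Num.Theory.pnatr_eq0.
have Q0 : (#|F| ^ k.+1).-1%:R != 0 :> rat.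
  by rewrite Num.Theory.pnatr_eq0 -lt0n ltn_predRL.
rewrite mulf_div -natrM -(card_TSRP_Pq iota hL hn) -mulnA !natrM.
by rewrite mulfK // mulf_neq0.
Qed.
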